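(* Let $X$ be an adapted, spread out random walk on $E$ with law $v$ that is $R$-recurrent in the sense of Tweedie, where $R$ is the convergence parameter of $X$. Let $\varphi$ be the unique continuous exponential on $E$ satisfying $R=\bigl[\int_E\varphi\,dv\bigr]^{-1}$, and let $\tilde X$ be the random walk on $E$ whose law is the probability measure $\tilde v=R\varphi v$, i.e. $\tilde v(A)=R\int_A\varphi\,dv$. Then $\tilde X$ is a Harris random walk, and hence the group $E$ is recurrent.
   Context: $E$ is a locally compact group with countable base, written multiplicatively, with Borel $\sigma$-algebra $\mathcal{E}$; $\pi$ is a fixed right Haar measure, and $\mathcal{E}_+=\{A\in\mathcal{E}:\pi(A)>0\}$. A random walk $X=(X_n)_{n\ge0}$ on $E$ with law $v$ (a Borel probability measure on $E$) is the Markov chain with $n$-step transition probabilities $p(n,x,A)=v^n(x^{-1}A)$, where $v^n$ is the $n$-th convolution power of $v$ ($v^0$ is the unit mass at the identity); $P_x$ is the law of the chain started at $x$. $X$ is adapted if the smallest closed subgroup of $E$ containing the support of $v$ is $E$. $X$ is spread out if for some $n\ge1$ the measure $v^n$ is nonsingular with respect to $\pi$. $X$ is $\pi$-irreducible if $\sum_{n\ge1}p(n,x,A)>0$ for all $x\in E$, $A\in\mathcal{E}_+$. For a $\pi$-irreducible $X$ and $r\ge 0$ put $G^{(r)}(x,A)=\sum_{n\ge0}r^n p(n,x,A)$. The convergence parameter $R\in[1,\infty)$ of $X$ is the supremum of those $r\ge0$ for which $G^{(r)}(x,A)<\infty$ for some $x\in E$ and some $A\in\mathcal{E}_+$. $X$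 is $R$-recurrent in the sense of Tweedie if it is $\pi$-irreducible with convergence parameter $R$ and $G^{(R)}(x,A)=\infty$ for all $x\in E$ and $A\in\mathcal{E}_+$. An exponential on $E$ is a Borel function $\varphi:E\to(0,\infty)$ with $\varphi(xy)=\varphi(x)\varphi(y)$ for all $x,y\in E$. For $X$ as in the claim, there is exactly one continuous exponential $\varphi$ with $\int\varphi\,dv=1/R$. A random walk is a Harris random walk if it is $\pi$-irreducible and, for every $x\in E$ and $B\in\mathcal{E}_+$, the walk started at $x$ visits $B$ infinitely often with probability $1$. An adapted random walk on $E$ is recurrent if, for every starting point $x\in E$, it visits every nonempty open subset of $E$ infinitely often with probability $1$. The group $E$ is recurrent if there exists at least one (adapted) recurrent random walk on $E$. *)

(* Defs.v *)
From HB Require Import structures.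
From mathcomp Require Import all_boot all_order all_algebra.
From mathcomp Require Import all_classical all_reals all_analysis.

Set Implicit Arguments.
Unset Strict Implicit.
Unset Printing Implicit Defensive.

Import Order.TTheory GRing.Theory Num.Theory.
Import numFieldNormedType.Exports.

Local Open Scope classical_set_scope.
Local Open Scope ring_scope.
Local Open Scope ereal_scope.

HB.structure Definition PreTopologicalGroup := {E of Topological E & Group E}.

HB.mixin Record PreTopologicalGroup_isTopologicalGroup E
    & PreTopologicalGroup E := {
  mulg_continuous : continuous (fun z : E * E => (z.1 * z.2)%g) ;
  invg_continuous : continuous (fun x : E => (x^-1)%g)
}.

#[short(type="topologicalGroupType")]
HB.structure Definition TopologicalGroup :=
  {E of PreTopologicalGroup E & PreTopologicalGroup_isTopologicalGroup E}.

HB.mixin Record isBorelLcscGroup (d : measure_display) E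
    & TopologicalGroup E & Measurable d E := {
  lcsc_hausdorff : hausdorff_space E ;
  lcsc_locally_compact : locally_compact [set: E] ;
  lcsc_second_countable : @second_countable E ;
  lcsc_borel : @measurable d E = <<s @open E >>
}.

(* Locally compact groups are Hausdorff here, as usual. *)
#[short(type="lcscGroupType")]
HB.structure Definition LcscGroup d :=
  {E of TopologicalGroup E & Measurable d E & isBorelLcscGroup d E}.
Section multiplication.
Context (d : measure_display) (E : lcscGroupType d).

Definition mulg_pair (z : E * E) : E := (z.1 * z.2)%g.

Lemma measurable_mulg_pair : measurable_fun [set: E * E] mulg_pair.
Proof.
have [B cB [Bo Bnbhs]] := @lcsc_second_countable d E.
apply: (measurability open); first exact: lcsc_borel.
move=> _ [U oU <-]; rewrite setTI.
set W := _ @^-1` U.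
have oW : open W.
  by apply: open_comp => // z _; exact: mulg_continuous.
have mB V : B V -> measurable V.
  by move=> BV; rewrite lcsc_borel; apply: sub_sigma_algebra; exact: Bo.
pose I := [set F : set E * set E | (B `*` B) F /\ F.1 `*` F.2 `<=` W].
have -> : W = \bigcup_(F in I) (F.1 `*` F.2).
  apply/seteqP; split=> [[x y] Wxy|z [F [_ FW] Fz]]; last exact: FW.
  have : nbhs (x, y) W by apply: open_nbhs_nbhs.
  move=> -[[P Q]/= [/Bnbhs[V [BV Vx] VP] /Bnbhs[V' [BV' V'y] VQ]]] PQW.
  exists (V, V') => //; split=> //= -[a b] [/= Va Vb].
  by apply: PQW; split; [exact: VP|exact: VQ].
have /countable_injP[f fI] : countable I.
  by apply: (sub_countable _ (countableX cB cB)); apply: subset_card_le => F [].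
have -> : \bigcup_(F in I) (F.1 `*` F.2) =
    \bigcup_n \bigcup_(F in [set F | I F /\ f F = n]) (F.1 `*` F.2).
  apply/seteqP; split=> [z [F IF Fz]|z [n _ [F [IF _] Fz]]]; last by exists F.
  by exists (f F) => //; exists F.
apply: bigcupT_measurable => n.
have [[F [IF fFn]]|noF] := pselect (exists F, I F /\ f F = n); last first.
  rewrite (_ : \bigcup_(_ in _) _ = set0)//.
  by apply/seteqP; split=> // z [F IF _]; apply: noF; exists F.
rewrite (_ : \bigcup_(_ in _) _ = F.1 `*` F.2).
  by case: IF => -[BF1 BF2] _; apply: measurableX; exact: mB.
apply/seteqP; split=> [z [G [IG fGn] Gz]|z Fz]; last by exists F.
by rewrite (_ : F = G)//; apply: fI; rewrite ?inE// fFn fGn.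
Qed.

HB.instance Definition _ :=
  isMeasurableFun.Build _ _ _ _ mulg_pair measurable_mulg_pair.

End multiplication.

Section random_walk_law.
Context (d : measure_display) (E : lcscGroupType d) (R : realType).
Implicit Types (v mu : probability E R) (pi : {measure set E -> \bar R}).

Definition convolution mu v : probability E R :=
  distribution (mu \x v) (@mulg_pair d E).

Fixpoint convolution_power v n : probability E R :=
  if n is n'.+1 then convolution (convolution_power v n') v
  else \d_(1%g : E).

Definition transition v n (x : E) (A : set E) : \bar R :=
  convolution_power v n [set (x^-1 * y)%g | y in A].

(* Regularity and sigma-finiteness are automatic, as the group is second
   countable. *)
Definition right_haar pi :=
  [/\ pi [set: E] != 0,
      forall K : set E, compact K -> pi K < +oo &
      forall (x : E) (A : set E), measurable A ->
        pi [set (y * x)%g | y in A] = pi A].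

Definition positive_sets pi : set (set E) :=
  [set A | measurable A /\ 0 < pi A].

Definition measure_support v : set E :=
  [set x | forall U : set E, open U -> U x -> 0 < v U].

Definition closed_subgroup (H : set E) := closed H /\ group_closed [in H].

Definition adapted v :=
  smallest closed_subgroup (measure_support v) = [set: E].

Definition mutually_singular (mu1 mu2 : {measure set E -> \bar R}) :=
  exists N : set E, [/\ measurable N, mu1 N = 0 & mu2 (~` N) = 0].

Definition spread_out pi v :=
  exists n, (0 < n)%N /\ ~ mutually_singular (convolution_power v n) pi.

Definition irreducible pi v := forall x A, positive_sets pi A ->
  0 < \sum_(1 <= n <oo) transition v n x A.

Definition green v (r : R) (x : E) (A : set E) : \bar R :=
  \sum_(n <oo) (r ^+ n)%:E * transition v n x A.

Definition convergence_parameter pi v : \bar R :=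
  ereal_sup [set r%:E | r in [set r : R | (0 <= r)%R /\
    exists x A, positive_sets pi A /\ green v r x A < +oo]].

Definition tweedie_recurrent pi v (r : R) :=
  [/\ irreducible pi v, convergence_parameter pi v = r%:E &
      forall x A, positive_sets pi A -> green v r x A = +oo].

Definition exponential (phi : E -> R) :=
  [/\ measurable_fun [set: E] phi, forall x, (0 < phi x)%R &
      forall x y, phi (x * y)%g = (phi x * phi y)%R].

End random_walk_law.

Section random_walk.
Context (d : measure_display) (E : lcscGroupType d) (R : realType).
Context (d' : measure_display) (Om : measurableType d').
Implicit Types (v : probability E R) (pi : {measure set E -> \bar R}).
Implicit Types (X : nat -> Om -> E) (P : E -> probability Om R).

Definition history X (n : nat) : set (set Om) :=
  <<s \bigcup_(k in `I_n.+1) g_sigma_algebra_preimage (X k) >>.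

(* [P x] is the law of the chain started at [x]; the last clause says that
   [P x (X (m + n) \in B | X 0, X 1, ... X m) = transition v n (X m) B]
   [P x]-almost surely. *)
Definition random_walk v X P :=
  [/\ forall n, measurable_fun [set: Om] (X n),
      forall x, P x (X 0%N @^-1` [set x]) = 1 &
      forall (x : E) (m n : nat) (F : set Om) (B : set E),
        history X m F -> measurable B ->
        P x (F `&` X (m + n)%N @^-1` B) =
        \int[P x]_(w in F) transition v n (X m w) B].

Definition infinitely_often X (B : set E) : set Om :=
  lim_sup_set (fun n => X n @^-1` B).

Definition harris pi v X P :=
  [/\ random_walk v X P, irreducible pi v &
      forall x B, positive_sets pi B -> P x (infinitely_often X B) = 1].

Definition recurrent_walk v X P :=
  [/\ random_walk v X P, adapted v &
      forall x (U : set E), open U -> U !=set0 ->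
        P x (infinitely_often X U) = 1].

End random_walk.

Definition recurrent_group (d : measure_display) (E : lcscGroupType d)
    (R : realType) :=
  exists (d' : measure_display) (Om : measurableType d')
    (v : probability E R) (X : nat -> Om -> E) (P : E -> probability Om R),
    recurrent_walk v X P.

(* Main.v *)
Require Import Defs.
From HB Require Import structures.
From mathcomp Require Import all_boot all_order all_algebra.
From mathcomp Require Import all_classical all_reals all_analysis.
From mathcomp Require Import finmap measurable_realfun measurable_fun_approximation.

(** Write [mu] for the law [rho phi v] of the tilted walk.  Since [phi] is
    multiplicative, tilting is a Doob transform: the transition operators [P] of
    the original walk and [Q] of the tilted one satisfy
    [phi * Q^n f = rho^n * P^n (phi * f)] ([steps_tilt]).  As [phi] is positive,
    [mu] therefore inherits from [v] irreducibility, spreading out and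
    adaptedness, and the divergence of [\sum_n rho^n v^n] on the positive sets
    becomes the divergence of the plain Green function
    [\sum_n mu^n] on these sets ([green_tilt]).  So everything reduces to an
    ordinary walk: an irreducible spread-out walk whose Green function is
    infinite on all positive sets is Harris.

    Fix a positive set [B] and let [escape x] be the probability that the walk
    started at [x] does not visit [B] at any time [n >= 1].  Counting
    the last visit to [B] gives
    [\sum_(1 <= n <= N) Q^n (escape 1_B) + escape = Q^N escape <= 1]
    ([sum_steps_escape]), so the potential of [escape 1_B] is bounded; as the
    potential of every positive set is infinite, [escape] vanishes
    [pi]-a.e. on [B] ([ae_escape_eq0]).

    Let [w = lim_k Q^k escape], the probability of finitely many visits; it is
    harmonic.  A right Haar measure is invariant under the walk, so [Q] preserves
    vanishing [pi]-a.e. and the displayed identity gives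
    [w = escape = 0] at almost every point of [B].  A nonnegative harmonic
    function that vanishes at one point vanishes a.e. by irreducibility
    ([irreducible_ae0]).  To pass from a.e. to everywhere, irreducibility also
    shows that left translates of null sets are null ([ae0_lmulg]), and since
    some power [mu^n] is not singular, it gives every null set a mass less
    than 1.  If the values of [w] at the points [x_i] tend to [s = sup w], let
    [N] be a null set outside of which all the [w (x_i y)] vanish: then
    [w (x_i) = \int w (x_i y) mu^n(dy) <= s mu^n(N)], hence
    [s <= s mu^n(N)] and [s = 0] ([harmonic_eq0]).

    Thus [escape = 0] everywhere, and the Markov property turns this into
    infinitely many visits to [B] almost surely, from every starting point
    ([infinitely_often_escape0]).  Nonempty open sets are positive for a Haar
    measure, so the tilted walk is a recurrent walk on the group. *)

Set Implicit Arguments.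
Unset Strict Implicit.
Unset Printing Implicit Defensive.

Import Order.TTheory GRing.Theory Num.Theory.
Import numFieldNormedType.Exports.

Local Open Scope classical_set_scope.
Local Open Scope ring_scope.
Local Open Scope ereal_scope.

(** * Induction on nonnegative measurable functions *)

Section ge0_measurable_ind.
Context d (T : measurableType d) (R : realType).
Import HBNNSimple.

(** The usual induction principle: nonnegative measurable functions are
    increasing limits of nonnegative combinations of indicators.  It extends
    to functions the identities between measures that define the tilted law
    and the Markov property. *)
Lemma ge0_measurable_ind (Q : (T -> \bar R) -> Prop) :
  (forall A, measurable A -> Q (fun x => (\1_A x)%:E)) ->
  (forall f g : T -> \bar R,
    measurable_fun [set: T] f -> measurable_fun [set: T] g ->
    (forall x, 0 <= f x) -> (forall x, 0 <= g x) -> Q f -> Q g ->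
    Q (fun x => f x + g x)) ->
  (forall (k : R) (f : T -> \bar R),
    measurable_fun [set: T] f -> (forall x, 0 <= f x) ->
    (0 <= k)%R -> Q f -> Q (fun x => k%:E * f x)) ->
  (forall f_ : nat -> T -> \bar R,
    (forall n, measurable_fun [set: T] (f_ n)) ->
    (forall n x, 0 <= f_ n x) ->
    (forall x, nondecreasing_seq (f_ ^~ x)) ->
    (forall n, Q (f_ n)) -> Q (fun x => limn (f_ ^~ x))) ->
  forall f : T -> \bar R, measurable_fun [set: T] f -> (forall x, 0 <= f x) -> Q f.
Proof.
move=> Q1 QD QZ Qlim f mf f0.
have Qsfun (g : {nnsfun T >-> R}) : Q (fun x => (g x)%:E).
  suff Qsum (s : seq R) : {in s, forall y, (0 <= y)%R} ->
      Q (fun x => \sum_(y <- s) (y * \1_(g @^-1` [set y]) x)%:E).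
    rewrite [X in Q X](_ : _ = (fun x => \sum_(y <- fset_set (range g))
        (y * \1_(g @^-1` [set y]) x)%:E)).
      apply: Qsum => y yg.
      have : (y \in fset_set (range g))%fset by [].
      by rewrite in_fset_set//; move=> /set_mem[x _ <-].
    by apply/funext => x; rewrite fimfunE fsbig_finite//= sumEFin.
  elim: s => [|y s IH] s0.
    have -> : (fun x => \sum_(y <- [::]) (y * \1_(g @^-1` [set y]) x)%:E) =
       (fun x => (\1_(set0 : set T) x)%:E :> \bar R).
      by apply/funext => x; rewrite big_nil indic0.
    exact: Q1.
  under eq_fun do rewrite big_cons.
  have y0 : (0 <= y)%R by apply: s0; rewrite inE eqxx.
  have mi z : measurable_fun [set: T] (fun x => (\1_(g @^-1` [set z]) x : R)%:E).
    exact/measurable_EFinP/measurable_indic.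
  have mz z : measurable_fun [set: T] (fun x => (z * \1_(g @^-1` [set z]) x)%:E).
    by apply/measurable_EFinP; apply: measurable_funM => //; exact/measurable_EFinP.
  have s0' : {in s, forall z, (0 <= z)%R}.
    by move=> z zs; apply: s0; rewrite inE zs orbT.
  apply: QD; [exact: mz|exact: emeasurable_sum| | | |exact: IH].
  - by move=> x; rewrite lee_fin mulr_ge0.
  - move=> x; rewrite big_seq; apply: sume_ge0 => z zs.
    by rewrite lee_fin mulr_ge0// s0'.
  - under eq_fun do rewrite EFinM.
    by apply: QZ; [exact: mi|move=> x; rewrite lee_fin|exact: y0|exact: Q1].
have -> : f = (fun x => limn (fun n => (nnsfun_approx measurableT mf n x)%:E)).
  by apply/funext => x; apply/esym/cvg_lim => //; exact: cvg_nnsfun_approx.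
apply: (Qlim (fun n x => (nnsfun_approx measurableT mf n x)%:E)) => //.
- by move=> n; exact/measurable_EFinP.
- by move=> n x; rewrite lee_fin.
- by move=> x m n mn; rewrite lee_fin; exact/lefP/nd_nnsfun_approx.
Qed.

End ge0_measurable_ind.

(** * The transition operator of a random walk *)

Section step.
Context (d : measure_display) (E : lcscGroupType d) (R : realType).
Implicit Types (f g : E -> \bar R) (A : set E).

Lemma measurable_lmulg (x : E) : measurable_fun [set: E] (fun y => (x * y)%g).
Proof.
exact: (measurable_fun_pair2 x (@measurable_mulg_pair d E)).
Qed.

Lemma measurable_rmulg (y : E) : measurable_fun [set: E] (fun x => (x * y)%g).
Proof.
exact: (measurable_fun_pair1 y (@measurable_mulg_pair d E)).
Qed.

Lemma measurable_comp_lmulg f (x : E) : measurable_fun [set: E] f ->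
  measurable_fun [set: E] (fun y => f (x * y)%g).
Proof. by move=> mf; exact: (measurableT_comp mf (measurable_lmulg x)). Qed.

Lemma measurable_comp_rmulg f (y : E) : measurable_fun [set: E] f ->
  measurable_fun [set: E] (fun x => f (x * y)%g).
Proof. by move=> mf; exact: (measurableT_comp mf (measurable_rmulg y)). Qed.

Variable mu : probability E R.

Definition step f : E -> \bar R := fun x => \int[mu]_y f (x * y)%g.

Lemma measurable_step f : measurable_fun [set: E] f -> (forall x, 0 <= f x) ->
  measurable_fun [set: E] (step f).
Proof.
move=> mf f0; apply: (measurable_fun_fubini_tonelli_F (f \o @mulg_pair d E)).
  exact: (measurableT_comp mf (@measurable_mulg_pair d E)).
by move=> z; exact: f0.
Qed.

Lemma step_ge0 f : (forall x, 0 <= f x) -> forall x, 0 <= step f x.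
Proof. by move=> f0 x; apply: integral_ge0. Qed.

Lemma le_step f g : measurable_fun [set: E] f -> measurable_fun [set: E] g ->
  (forall x, 0 <= f x) -> (forall x, f x <= g x) ->
  forall x, step f x <= step g x.
Proof.
move=> mf mg f0 fg x; apply: ge0_le_integral => //.
- exact: measurable_comp_lmulg.
- exact: measurable_comp_lmulg.
Qed.

Lemma stepD f g : measurable_fun [set: E] f -> measurable_fun [set: E] g ->
  (forall x, 0 <= f x) -> (forall x, 0 <= g x) ->
  step (f \+ g) = step f \+ step g.
Proof.
move=> mf mg f0 g0; apply/funext => x; rewrite /step /= ge0_integralD//.
- exact: measurable_comp_lmulg.
- exact: measurable_comp_lmulg.
Qed.

Lemma stepZ (c : R) f : measurable_fun [set: E] f -> (forall x, 0 <= f x) ->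
  (0 <= c)%R -> step (fun x => c%:E * f x) = fun x => c%:E * step f x.
Proof.
move=> mf f0 c0; apply/funext => x; rewrite /step /= ge0_integralZl_EFin//.
exact: measurable_comp_lmulg.
Qed.

Lemma step_cst1 : step (cst 1) = cst 1.
Proof.
apply/funext => x; rewrite /step (integral_cst mu measurableT 1) mul1e.
exact: probability_setT.
Qed.

(** The walk is homogeneous: left translations commute with the transition
    operator, because the increments act on the right. *)
Lemma step_translate f x :
  step (fun y => f (x * y)%g) = fun y => step f (x * y)%g.
Proof.
by apply/funext => y; apply: eq_integral => z _; rewrite mulgA.
Qed.

Lemma step_lim (f_ : nat -> E -> \bar R) :
  (forall n, measurable_fun [set: E] (f_ n)) -> (forall n x, 0 <= f_ n x) ->
  (forall x, nondecreasing_seq (f_ ^~ x)) ->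
  step (fun x => limn (f_ ^~ x)) = fun x => limn (fun n => step (f_ n) x).
Proof.
move=> mf f0 ndf; apply/funext => x.
apply: (@monotone_convergence _ _ _ mu _ measurableT (fun n y => f_ n (x * y)%g)).
- by move=> n; exact: measurable_comp_lmulg.
- by move=> n y _; exact: f0.
- by move=> y _; exact: ndf.
Qed.

Definition steps n f := iter n step f.

Lemma stepsS n f : steps n.+1 f = step (steps n f). Proof. by []. Qed.

Lemma stepsSr n f : steps n.+1 f = steps n (step f).
Proof. exact: iterSr. Qed.

Lemma steps_ge0 n f : (forall x, 0 <= f x) -> forall x, 0 <= steps n f x.
Proof. by move=> f0; elim: n => // n IH; exact: step_ge0. Qed.

Lemma measurable_steps n f : measurable_fun [set: E] f ->
  (forall x, 0 <= f x) -> measurable_fun [set: E] (steps n f).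
Proof.
by move=> mf f0; elim: n => // n IH; apply: measurable_step => //; exact: steps_ge0.
Qed.

Lemma le_steps n f g : measurable_fun [set: E] f -> measurable_fun [set: E] g ->
  (forall x, 0 <= f x) -> (forall x, f x <= g x) ->
  forall x, steps n f x <= steps n g x.
Proof.
move=> mf mg f0 fg; elim: n => // n IH; apply: le_step => //.
- exact: measurable_steps.
- by apply: measurable_steps => // x; exact: le_trans (fg x).
- exact: steps_ge0.
Qed.

Lemma stepsD n f g : measurable_fun [set: E] f -> measurable_fun [set: E] g ->
  (forall x, 0 <= f x) -> (forall x, 0 <= g x) ->
  steps n (f \+ g) = steps n f \+ steps n g.
Proof.
move=> mf mg f0 g0; elim: n => // n IH; rewrite stepsS IH stepD//.
- exact: measurable_steps.
- exact: measurable_steps.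
- exact: steps_ge0.
- exact: steps_ge0.
Qed.

Lemma stepsZ n (c : R) f : measurable_fun [set: E] f -> (forall x, 0 <= f x) ->
  (0 <= c)%R -> steps n (fun x => c%:E * f x) = fun x => c%:E * steps n f x.
Proof.
move=> mf f0 c0; elim: n => // n IH; rewrite stepsS IH stepZ//.
- exact: measurable_steps.
- exact: steps_ge0.
Qed.

Lemma steps_translate n f x :
  steps n (fun y => f (x * y)%g) = fun y => steps n f (x * y)%g.
Proof. by elim: n => // n IH; rewrite stepsS IH step_translate. Qed.

Lemma steps_le1 n f : measurable_fun [set: E] f -> (forall x, 0 <= f x) ->
  (forall x, f x <= 1) -> forall x, steps n f x <= 1.
Proof.
move=> mf f0 f1 x; have -> : 1 = steps n (cst 1) x :> \bar R.
  by elim: n => // n IH; rewrite stepsSr step_cst1.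
by apply: le_steps => //; exact: measurable_cst.
Qed.

Lemma ge0_integral_convolution (m1 m2 : probability E R) f :
  measurable_fun [set: E] f -> (forall x, 0 <= f x) ->
  \int[convolution m1 m2]_x f x = \int[m1]_x \int[m2]_y f (x * y)%g.
Proof.
move=> mf f0; rewrite ge0_integral_distribution//.
rewrite (@fubini_tonelli1 _ _ _ _ _ m1 m2 (f \o @mulg_pair d E))//=.
exact: (measurableT_comp mf (@measurable_mulg_pair d E)).
Qed.

(** Convolving with one more factor on the right composes with one more
    [step], so that the iterates of [step] are the integrals against the
    convolution powers. *)
Lemma stepsE n f x : measurable_fun [set: E] f -> (forall x, 0 <= f x) ->
  \int[convolution_power mu n]_y f (x * y)%g = steps n f x.
Proof.
elim: n f x => [|n IH] f x mf f0.
  rewrite /= integral_dirac//; last first.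
    exact: measurable_comp_lmulg.
  by rewrite diracT mul1e mulg1.
rewrite stepsSr -IH; [|exact: measurable_step|exact: step_ge0].
transitivity (\int[convolution_power mu n]_y \int[mu]_z f (x * (y * z))%g).
  by apply: (@ge0_integral_convolution _ _ (fun y => f (x * y)%g)) => //;
    exact: measurable_comp_lmulg.
by apply: eq_integral => y _; apply: eq_integral => z _; rewrite mulgA.
Qed.

Lemma transitionE n x A : measurable A ->
  transition mu n x A = steps n (fun y => (\1_A y)%:E) x.
Proof.
move=> mA; rewrite -stepsE; last 2 first.
- exact/measurable_EFinP/measurable_indic.
- by move=> y; rewrite lee_fin.
have -> : (fun y => (\1_A (x * y)%g)%:E) =
    (fun y => (\1_([set (x^-1 * z)%g | z in A]) y)%:E :> \bar R).
  apply/funext => y; rewrite !indicE; congr ((nat_of_bool _)%:R%:E).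
  apply/idP/idP => /set_mem Hy; apply/mem_set.
    by exists (x * y)%g => //; rewrite mulKg.
  by move: Hy => [z Az <-]; rewrite mulVKg.
rewrite integral_indic//; first by rewrite setIT.
rewrite (_ : [set (x^-1 * z)%g | z in A] = (fun y => (x * y)%g) @^-1` A).
  by rewrite -[X in measurable X]setTI; exact: measurable_lmulg.
apply/seteqP; split => y /=; first by move=> [z Az <-]; rewrite mulVKg.
by exists (x * y)%g => //; rewrite mulKg.
Qed.

End step.

(** * Escaping from a set *)

Section escape.
Context (d : measure_display) (E : lcscGroupType d) (R : realType).
Variables (mu : probability E R) (B : set E).
Hypothesis mB : measurable B.
Local Notation step := (step mu).
Local Notation steps := (steps mu).

Lemma measurable_patch (A : set E) (f : E -> \bar R) : measurable A ->
  measurable_fun [set: E] f -> measurable_fun [set: E] (f \_ A).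
Proof.
by move=> mA mf; apply/(measurable_restrictT _ mA).1; exact: measurable_funTS.
Qed.

(** [avoid m x] is the probability that the walk started at [x] stays out of
    [B] at the times [1, ..., m]; the starting point itself is not tested. *)
Definition avoid m : E -> \bar R := iter m (fun f => step (f \_ (~` B))) (cst 1).

Lemma avoidS m : avoid m.+1 = step (avoid m \_ (~` B)). Proof. by []. Qed.

Lemma avoid_ge0 m x : 0 <= avoid m x.
Proof.
elim: m x => [|m IH] x /=; first exact: lee01.
by apply: step_ge0 => y; exact: erestrict_ge0.
Qed.

Lemma measurable_avoid m : measurable_fun [set: E] (avoid m).
Proof.
elim: m => [|m IH] /=; first exact: measurable_cst.
apply: measurable_step.
  by apply: measurable_patch => //; exact: measurableC.
by move=> x; apply: erestrict_ge0 => z _; exact: avoid_ge0.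
Qed.

Lemma avoidS_le m x : avoid m.+1 x <= avoid m x.
Proof.
elim: m x => [|m IH] x.
  apply: (@steps_le1 _ _ _ mu 1) => [|y|y].
  - by apply: measurable_patch; [exact: measurableC|exact: measurable_cst].
  - exact: erestrict_ge0.
  - by rewrite patchE; case: ifP.
rewrite avoidS [in leRHS]avoidS; apply: le_step => [| |y|y].
- by apply: measurable_patch; [exact: measurableC|exact: measurable_avoid].
- by apply: measurable_patch; [exact: measurableC|exact: measurable_avoid].
- by apply: erestrict_ge0 => z _; exact: avoid_ge0.
- by rewrite !patchE; case: ifP.
Qed.

Lemma avoid_nonincreasing x : nonincreasing_seq (avoid ^~ x).
Proof. by apply/nonincreasing_seqP => n; exact: avoidS_le. Qed.

Lemma avoid_le1 m x : avoid m x <= 1.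
Proof. exact: (avoid_nonincreasing x (leq0n m)). Qed.

(** The probability of never visiting [B] after time [0]. *)
Definition escape x := limn (avoid ^~ x).

Lemma avoid_cvg x : avoid m x @[m --> \oo] --> escape x.
Proof. exact: ereal_nonincreasing_is_cvgn (avoid_nonincreasing x). Qed.

Lemma escape_ge0 x : 0 <= escape x.
Proof.
apply: lime_ge; first exact: avoid_cvg.
by apply: nearW => m; exact: avoid_ge0.
Qed.

Lemma escape_le1 x : escape x <= 1.
Proof.
apply: lime_le; first exact: avoid_cvg.
by apply: nearW => m; exact: avoid_le1.
Qed.

Lemma measurable_escape : measurable_fun [set: E] escape.
Proof.
apply: (emeasurable_fun_cvg (fun m : nat => avoid m)) => [m|x _].
  exact: measurable_avoid.
exact: avoid_cvg.
Qed.

(** Dominated convergence by 1, with an arbitrary reading [g] of the position: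
    it is used both for one increment of the walk and for its position
    on the sample space. *)
Lemma integral_avoid_cvg (d' : measure_display) (T : measurableType d')
    (P : probability T R) (g : T -> E) (F : set T) :
  measurable F -> measurable_fun [set: T] g ->
  \int[P]_(t in F) avoid m (g t) @[m --> \oo] --> \int[P]_(t in F) escape (g t).
Proof.
move=> mF mg.
have [] // := @dominated_convergence _ _ _ P F mF (fun m t => avoid m (g t))
  (fun t => escape (g t)) (cst 1).
- move=> m; apply: measurable_funTS; apply: measurableT_comp mg.
  exact: measurable_avoid.
- by apply: measurable_funTS; apply: measurableT_comp mg; exact: measurable_escape.
- by apply: aeW => t _; exact: avoid_cvg.
- apply: (@integrableS _ _ _ P setT) => //.
  exact: finite_measure_integrable_cst.
- by apply: aeW => t m _; rewrite gee0_abs ?avoid_ge0// avoid_le1.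
Qed.

Lemma step_restrict (A : set E) (f : E -> \bar R) x :
  step (f \_ A) x = \int[mu]_(y in (fun y => (x * y)%g) @^-1` A) f (x * y)%g.
Proof. by rewrite [RHS]integral_mkcond; apply: eq_integral => y _; rewrite !patchE. Qed.

Lemma escapeE : step (escape \_ (~` B)) = escape.
Proof.
apply/funext => x; rewrite step_restrict.
have mxB : measurable ((fun y => (x * y)%g) @^-1` (~` B)).
  rewrite -[X in measurable X]setTI; apply: measurable_lmulg => //.
  exact: measurableC.
have cv := @integral_avoid_cvg _ _ mu _ _ mxB (measurable_lmulg x).
have cv' : avoid m.+1 x @[m --> \oo] --> escape x.
  by rewrite (cvg_shiftS (avoid ^~ x)); exact: avoid_cvg.
rewrite (_ : (fun m => _) = (fun m =>
  \int[mu]_(t in (fun y => (x * y)%g) @^-1` (~` B)) avoid m (x * t)%g)) in cv'.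
  exact: cvg_unique cv cv'.
by apply/funext => m; rewrite avoidS step_restrict.
Qed.

Lemma measurable_restrict_escape A : measurable A ->
  measurable_fun [set: E] (escape \_ A).
Proof. by move=> mA; apply: measurable_patch => //; exact: measurable_escape. Qed.

Lemma restrict_escape_ge0 A x : 0 <= (escape \_ A) x.
Proof. by apply: erestrict_ge0 => y _; exact: escape_ge0. Qed.

(** Never visiting [B] at the times [n >= 2] means either visiting [B] at time 1
    for the last time, or never visiting it at all after time 0. *)
Lemma step_escape : step escape = step (escape \_ B) \+ escape.
Proof.
rewrite -[in X in _ \+ X]escapeE -stepD.
- by congr (step _); apply/funext => x; rewrite /= {1}(funID B escape) addeC.
- exact: measurable_restrict_escape.
- exact/measurable_restrict_escape/measurableC.
- exact: restrict_escape_ge0.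
- exact: restrict_escape_ge0.
Qed.

(** Decomposition according to the last visit to [B]: the paths that avoid [B]
    after time [N] either have a last visit to [B] at some time [1 <= n <= N],
    or avoid [B] at all times after 0. *)
Lemma sum_steps_escape N x :
  \sum_(1 <= n < N.+1) steps n (escape \_ B) x + escape x = steps N escape x.
Proof.
elim: N => [|N IH]; first by rewrite big_geq// add0e.
rewrite big_nat_recr// addeAC IH [in RHS]stepsSr step_escape stepsD.
- by rewrite /= addeC -stepsSr.
- exact/measurable_step/restrict_escape_ge0/measurable_restrict_escape.
- exact: measurable_escape.
- by apply: step_ge0; exact: restrict_escape_ge0.
- exact: escape_ge0.
Qed.

Lemma le_steps_escape N x : escape x <= steps N escape x.
Proof.
rewrite -sum_steps_escape leeDr//; apply: sume_ge0 => n _.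
by apply: steps_ge0; exact: restrict_escape_ge0.
Qed.

Lemma sum_steps_escape_le1 N x :
  \sum_(1 <= n < N.+1) steps n (escape \_ B) x <= 1.
Proof.
apply: (@le_trans _ _ (steps N escape x)).
  by rewrite -sum_steps_escape leeDl// escape_ge0.
by apply: steps_le1; [exact: measurable_escape|exact: escape_ge0|exact: escape_le1].
Qed.

End escape.

(** * Haar measure and null sets *)

Section sigma_finite_pack.
Context (d : measure_display) (T : measurableType d) (R : realType).
Variable m : {measure set T -> \bar R}.
Hypothesis m_sigma_finite : sigma_finite [set: T] m.

Let m' : set T -> \bar R := m.
HB.instance Definition _ := Measure.on m'.
HB.instance Definition _ := Measure_isSigmaFinite.Build d T R m' m_sigma_finite.

Lemma sigma_finite_measure_pack :
  exists n : {sigma_finite_measure set T -> \bar R}, n = m :> (set T -> \bar R).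
Proof. by exists m'. Qed.

End sigma_finite_pack.

Section haar.
Context (d : measure_display) (E : lcscGroupType d) (R : realType).

Lemma open_borel (U : set E) : open U -> measurable U.
Proof. by move=> oU; rewrite lcsc_borel; exact: sub_sigma_algebra. Qed.

(** The Lindelof property, in a form where the members of the countable
    cover may be taken small enough to satisfy a local property [Q].  The
    empty set pads the enumeration of the basis. *)
Lemma countable_open_cover (Q : set E -> Prop) : Q set0 ->
  (forall x, exists U, [/\ open U, U x &
     forall V, open V -> V `<=` U -> Q V]) ->
  exists F : nat -> set E,
    (forall n, open (F n) /\ Q (F n)) /\ \bigcup_n F n = [set: E].
Proof.
move=> Q0 QU; have [B /countable_injP[f fI] [Bo Bnbhs]] := @lcsc_second_countable d E.
pose C n V := [/\ B V, Q V & f V = n].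
pose F n := if pselect (exists V, C n V) is left CV then sval (cid CV) else set0.
exists F; split=> [n|].
  rewrite /F; case: pselect => [CV|_]; last by split=> //; exact: open0.
  by case: cid => V /= [BV QV _]; split=> //; exact: Bo.
apply/seteqP; split=> // x _; have [U [oU Ux QV]] := QU x.
have /Bnbhs[V [BV Vx] VU] : nbhs x U by apply: open_nbhs_nbhs.
exists (f V) => //; rewrite /F; case: pselect => [CV|]; last first.
  by case; exists V; split=> //; apply: QV => //; exact: Bo.
by case: cid => W /= [BW QW fWV]; rewrite (_ : W = V)//; apply: fI => //; exact/mem_set.
Qed.

Variable pi : {measure set E -> \bar R}.
Hypothesis pi_haar : right_haar pi.

Lemma haar_sigma_finite : sigma_finite [set: E] pi.
Proof.
case: pi_haar => _ piK _.
have [|x|F [oF FE]] := @countable_open_cover (fun U => pi U < +oo).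
- by rewrite measure0 ltry.
- have [K xK [cK clK]] := @lcsc_locally_compact d E x Logic.I.
  have {}xK : nbhs x K.
    exact: filterS (fun y (yK : [set: E] y -> K y) => yK Logic.I) xK.
  exists (interior K); split; [exact: open_interior|exact: xK|move=> V oV VK].
  apply: le_lt_trans (piK K cK); apply: le_measure.
  + exact/mem_set/open_borel.
  + by apply/mem_set; rewrite -[K]setCK; apply/measurableC/open_borel; exact: closed_openC.
  + by apply: (subset_trans VK); exact: interior_subset.
- by exists F => // n; have [oFn piFn] := oF n; split=> //; exact: open_borel.
Qed.

Lemma haar_preimage (a : E) (A : set E) : measurable A ->
  pi ((fun y => (y * a)%g) @^-1` A) = pi A.
Proof.
case: pi_haar => _ _ pi_inv mA; rewrite -(pi_inv a^-1%g A mA); congr (pi _).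
apply/seteqP; split=> [y Ay|_ [y Ay <-]] /=; last by rewrite mulgVK.
by exists (y * a)%g => //; rewrite mulgK.
Qed.

(** Right translates of a null open set would be null open neighborhoods of
    all the points, and countably many of them cover the group. *)
Lemma haar_open_gt0 (U : set E) : open U -> U !=set0 -> 0 < pi U.
Proof.
case: pi_haar => piE _ _ oU [u Uu]; rewrite lt0e measure_ge0 andbT.
apply: contra_neq piE => piU0.
have [|x|F [oF FE]] := @countable_open_cover (fun V => pi V = 0).
- exact: measure0.
- exists ((fun y => y * (x^-1 * u))%g @^-1` U); split.
  + apply: open_comp => // y _.
    apply: (@continuous_comp _ _ _ (fun y => (y, x^-1 * u)%g) (fun z => z.1 * z.2)%g).
      by apply: cvg_pair; [exact: cvg_id|exact: cvg_cst].
    exact: mulg_continuous.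
  + by rewrite /= mulgA mulgV mul1g.
  + move=> V oV VW; apply: (subset_measure0 _ _ VW); first exact: open_borel.
      rewrite -[X in measurable X]setTI; apply: measurable_rmulg => //.
      exact: open_borel.
    exact: etrans (haar_preimage _ (open_borel oU)) piU0.
- have /negligibleP <- : measurable [set: E] by [].
  by rewrite -FE; apply: negligible_bigcup => n; apply/negligibleP;
    have [oFn piFn] := oF n; first exact: open_borel.
Qed.

Lemma ge0_integral_eq0_ae (d' : measure_display) (T : measurableType d')
    (m : {measure set T -> \bar R}) (f : T -> \bar R) :
  measurable_fun [set: T] f -> (forall x, 0 <= f x) ->
  \int[m]_x f x = 0 <-> {ae m, forall x, f x = 0}.
Proof.
move=> mf f0; have := ae_eq_integral_abs m measurableT mf.
under eq_integral do rewrite gee0_abs//.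
move=> ->; split; apply: filterS => x; first by move=> /(_ Logic.I).
by move=> fx _; exact: fx.
Qed.

Lemma haar_ae_rmulg (f : E -> \bar R) (y : E) :
  {ae pi, forall x, f x = 0} -> {ae pi, forall x, f (x * y)%g = 0}.
Proof.
move=> [N [mN piN0 fN]]; exists ((fun x => (x * y)%g) @^-1` N); split.
- by rewrite -[X in measurable X]setTI; exact: measurable_rmulg.
- by rewrite haar_preimage.
- by move=> x /= fxy; exact: fN.
Qed.

(** A right Haar measure is invariant under the walk: by Tonelli, the integral
    of [step mu f] is the average over the increments [y] of the integrals of
    the right translates of [f] by [y]. *)
Lemma haar_ae_step (mu : probability E R) (f : E -> \bar R) :
  measurable_fun [set: E] f -> (forall x, 0 <= f x) ->
  {ae pi, forall x, f x = 0} -> {ae pi, forall x, step mu f x = 0}.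
Proof.
move=> mf f0 f_0.
have [m mE] := sigma_finite_measure_pack haar_sigma_finite.
suff : {ae m, forall x, step mu f x = 0} by rewrite mE.
have {}f_0 y : {ae m, forall x, f (x * y)%g = 0} by rewrite mE; exact: haar_ae_rmulg.
apply/ge0_integral_eq0_ae; [exact: measurable_step|exact: step_ge0|].
have := @fubini_tonelli _ _ _ _ _ m mu (f \o @mulg_pair d E).
move=> /(_ (measurableT_comp mf (@measurable_mulg_pair d E)) (fun z => f0 _)).
move=> /= tonelli; rewrite [LHS]tonelli; apply: integral0_eq => y _.
have [_ +] := @ge0_integral_eq0_ae _ _ m (fun x => f (x * y)%g)
  (measurable_comp_rmulg y mf) (fun x => f0 _).
by apply.
Qed.

Lemma haar_ae_steps (mu : probability E R) n (f : E -> \bar R) :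
  measurable_fun [set: E] f -> (forall x, 0 <= f x) ->
  {ae pi, forall x, f x = 0} -> {ae pi, forall x, steps mu n f x = 0}.
Proof.
move=> mf f0 f_0; elim: n => // n IH; apply: haar_ae_step => //.
- exact: measurable_steps.
- exact: steps_ge0.
Qed.

End haar.

(** * Functions killed by recurrence, irreducibility or spreading out *)

Section recurrence.
Context (d : measure_display) (E : lcscGroupType d) (R : realType).
Variables (pi : {measure set E -> \bar R}) (mu : probability E R).
Hypothesis pi_haar : right_haar pi.
Local Notation step := (step mu).
Local Notation steps := (steps mu).

(** The super-level sets at heights [1 / (k + 1)] exhaust the set where a
    nonnegative function is positive; they compare the function with
    indicators, to which the hypotheses on the walk apply. *)
Definition level (f : E -> \bar R) k := [set x | (k.+1%:R^-1)%:E <= f x].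

Lemma measurable_level f k : measurable_fun [set: E] f -> measurable (level f k).
Proof.
move=> mf; rewrite -[level f k]setTI.
by apply: emeasurable_fun_c_infty => //.
Qed.

Lemma level_transition f k n x : measurable_fun [set: E] f ->
  (forall y, 0 <= f y) ->
  (k.+1%:R^-1)%:E * transition mu n x (level f k) <= steps n f x.
Proof.
move=> mf f0; have ml := measurable_level k mf.
have mi : measurable_fun [set: E] (fun y => (\1_(level f k) y)%:E : \bar R).
  exact/measurable_EFinP/measurable_indic.
have i0 y : 0 <= (\1_(level f k) y)%:E :> \bar R by rewrite lee_fin.
rewrite transitionE// -[X in X <= _](congr1 (@^~ x) (stepsZ mu n mi i0 _))//.
apply: le_steps => // [|y].
- exact: measurable_funeM.
- rewrite indicE; have [/set_mem fy|_] := boolP (_ \in _); first by rewrite mule1.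
  by rewrite mule0.
Qed.

Lemma level_eq0 f x : (forall y, 0 <= f y) -> (forall k, ~ level f k x) -> f x = 0.
Proof.
move=> f0 fx; apply/eqP; rewrite eq_le f0 andbT leNgt; apply/negP => fx0.
suff [k kf] : exists k, (k.+1%:R^-1)%:E <= f x by exact: fx kf.
move: fx0; case: (f x) => [r r0| _|//]; last by exists 0%N; rewrite leey.
have [k kr] := ltr_add_invr r0.
by exists k; rewrite lee_fin ltW// -[ltLHS]add0r.
Qed.

Lemma ae0_level f : measurable_fun [set: E] f -> (forall y, 0 <= f y) ->
  (forall k, ~ positive_sets pi (level f k)) -> {ae pi, forall x, f x = 0}.
Proof.
move=> mf f0 nf.
have : pi.-negligible (\bigcup_k level f k).
  apply: negligible_bigcup => k; apply/negligibleP; first exact: measurable_level.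
  apply/eqP; rewrite eq_le measure_ge0 andbT leNgt; apply/negP => pif.
  by apply: (nf k); split=> //; exact: measurable_level.
apply: negligibleS => x /= fx; apply: contrapT => nlevel; apply: fx.
by apply: level_eq0 => // k kf; apply: nlevel; exists k.
Qed.

Lemma ae_exists (P : E -> Prop) A : {ae pi, forall x, P x} ->
  positive_sets pi A -> exists2 x, A x & P x.
Proof.
move=> [N [mN piN0 PN]] [mA piA]; apply: contrapT => nAP.
move: piA; rewrite (subset_measure0 mA mN _ piN0) ?ltxx// => x Ax.
by apply: PN => Px; apply: nAP; exists x.
Qed.

(** The Green function of a positive level set would be infinite, but up to a
    constant it is bounded by the potential of [f]. *)
Lemma ae0_bounded_potential f x (M : R) :
  (forall x A, positive_sets pi A -> \sum_(n <oo) transition mu n x A = +oo) ->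
  measurable_fun [set: E] f -> (forall y, 0 <= f y) ->
  (forall N, \sum_(0 <= n < N) steps n f x <= M%:E) -> {ae pi, forall x, f x = 0}.
Proof.
move=> green mf f0 fM; apply: ae0_level => // k /(green x) fk.
have k0 : (0 < (k.+1%:R : R))%R by rewrite ltr0n.
suff : \sum_(n <oo) transition mu n x (level f k) <= (k.+1%:R * M)%:E.
  by rewrite fk leye_eq.
apply: lime_le; first by apply: is_cvg_nneseries => n _ _; exact: measure_ge0.
apply: nearW => N; rewrite EFinM -lee_pdivrMl//.
apply: le_trans (fM N); rewrite ge0_sume_distrr; last by move=> n _; exact: measure_ge0.
by apply: lee_sum => n _; exact: level_transition.
Qed.

(** By irreducibility the walk started at [x] charges every positive level set
    of [f] at some time. *)
Lemma irreducible_ae0 (f : E -> \bar R) x : irreducible pi mu ->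
  measurable_fun [set: E] f -> (forall y, 0 <= f y) ->
  (forall n, steps n f x = 0) -> {ae pi, forall x, f x = 0}.
Proof.
move=> irr mf f0 fx; apply: ae0_level => // k /(irr x).
rewrite eseries0 ?ltxx// => n _ _; apply/eqP; rewrite eq_le measure_ge0 andbT.
have k0 : (0 < (k.+1%:R^-1 : R))%R by rewrite invr_gt0 ltr0n.
by rewrite -(pmule_rle0 _ (_ : 0 < (k.+1%:R^-1)%:E))// -(fx n); exact: level_transition.
Qed.

(** The measure [pi] is only right invariant, so null sets need an argument to
    be stable under left translations.  Almost every starting point [z] leads
    to [f = 0] at all times; the walk started at [x^-1 z] then leads to
    [y |-> f (x y) = 0] at all times, and irreducibility applies. *)
Lemma ae0_lmulg (f : E -> \bar R) x : irreducible pi mu ->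
  measurable_fun [set: E] f -> (forall y, 0 <= f y) ->
  {ae pi, forall y, f y = 0} -> {ae pi, forall y, f (x * y)%g = 0}.
Proof.
move=> irr mf f0 f_0.
have [z _ fz] : exists2 z, [set: E] z & forall n, steps n f z = 0.
  apply: ae_exists; first by apply: ae_foralln => n; exact: haar_ae_steps.
  by split=> //; apply: haar_open_gt0 => //; [exact: openT|exists 1%g].
apply: (@irreducible_ae0 _ (x^-1 * z)%g) => //; first exact: measurable_comp_lmulg.
by move=> n; rewrite steps_translate mulVKg.
Qed.

(** Absolute continuity of a part of [mu^n] improves a.e. vanishing to
    vanishing everywhere.  A single point [x] only gives
    [w x <= sup w * mu^n(N)] with [N] depending on [x]; a maximizing sequence
    makes one null set serve for the supremum, which is then contracted by a
    factor less than 1. *)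
Lemma harmonic_eq0 (w : E -> \bar R) n : irreducible pi mu ->
  ~ mutually_singular (convolution_power mu n) pi ->
  measurable_fun [set: E] w -> (forall x, 0 <= w x) -> (forall x, w x <= 1) ->
  step w = w -> {ae pi, forall x, w x = 0} -> forall x, w x = 0.
Proof.
move=> irr nsing mw w0 w1 wE w_0.
have wnE : steps n w = w by elim: n {nsing} => // k IH; rewrite stepsS IH.
pose s := ereal_sup (range w).
have [|u ru us] := @ereal_sup_seq R (range w).
  by apply/set0P; exists (w 1%g), 1%g.
have /choice[x_ x_u] : forall i, exists x, w x = u i.
  by move=> i; have [x _ <-] := ru i; exists x.
have {}us : u @ \oo --> s := us.
have s_ub x : w x <= s by apply: ereal_sup_ubound; exists x.
have s0 : 0 <= s by exact: le_trans (w0 1%g) (s_ub 1%g).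
have s1 : s <= 1 by apply: ge_ereal_sup => _ [x _ <-].
have [N [mN piN0 wN]] : {ae pi, forall y, forall i, w (x_ i * y)%g = 0}.
  by apply: ae_foralln => i; exact: ae0_lmulg.
have pN : convolution_power mu n N < 1.
  rewrite lt_neqAle probability_le1// andbT; apply/eqP => p1; apply: nsing.
  exists (~` N); split; [exact: measurableC| |by rewrite setCK].
  by have := probability_setC (convolution_power mu n) mN; rewrite p1 subee.
have sfin : s \is a fin_num by rewrite ge0_fin_numE// (le_lt_trans s1)// ltry.
move: s0 us s_ub {s1}; rewrite -(fineK sfin); set r := fine s => s0 us s_ub.
have rN : r%:E <= r%:E * convolution_power mu n N.
  rewrite -[leLHS](cvg_lim _ us)//; apply: lime_le; first by apply/cvg_ex; exists r%:E.
  apply: nearW => i; rewrite -x_u -{1}wnE -stepsE//.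
  rewrite -[in leRHS](setIT N) -(integral_indic _ measurableT mN).
  rewrite -ge0_integralZl_EFin; last 4 first.
  - by [].
  - by move=> y _; rewrite lee_fin.
  - exact/measurable_EFinP/measurable_indic.
  - by rewrite -lee_fin.
  apply: ge0_le_integral => // [||y _].
  - exact: measurable_comp_lmulg.
  - by apply: measurable_funeM; exact/measurable_EFinP/measurable_indic.
  - rewrite indicE; have [_|/negP yN] := boolP (y \in N); first by rewrite mule1.
    rewrite mule0 (_ : w _ = 0)//; apply: contrapT => wy; apply: yN; apply/mem_set.
    by apply: wN => /(_ i).
have r0 : r%:E <= 0.
  rewrite leNgt; apply/negP => r_gt0; move: pN; apply/negP; rewrite -leNgt.
  by rewrite -(lee_pmul2l _ r_gt0) ?mule1.
by move=> x; apply/eqP; rewrite eq_le w0 andbT (le_trans (s_ub x)).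
Qed.

End recurrence.

(** * A recurrent spread-out walk never escapes from a positive set *)

Section escape_eq0.
Context (d : measure_display) (E : lcscGroupType d) (R : realType).
Variables (pi : {measure set E -> \bar R}) (mu : probability E R) (B : set E).
Hypothesis pi_haar : right_haar pi.
Hypothesis mu_irr : irreducible pi mu.
Hypothesis mu_spread : spread_out pi mu.
Hypothesis mu_green : forall x A, positive_sets pi A ->
  \sum_(n <oo) transition mu n x A = +oo.
Hypothesis piB : positive_sets pi B.
Local Notation step := (step mu).
Local Notation steps := (steps mu).
Local Notation escape := (escape mu B).

Let mB : measurable B. Proof. by case: piB. Qed.
Let mesc : measurable_fun [set: E] escape. Proof. exact: measurable_escape. Qed.
Let esc0 x : 0 <= escape x. Proof. exact: escape_ge0. Qed.
Let mescB : measurable_fun [set: E] (escape \_ B).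
Proof. exact: measurable_restrict_escape. Qed.
Let escB0 x : 0 <= (escape \_ B) x. Proof. exact: restrict_escape_ge0. Qed.

(** The bound 2 is 1 for the term of index 0 and 1 for all the others
    together, by the last-visit decomposition. *)
Lemma ae_escape_eq0 : {ae pi, forall x, (escape \_ B) x = 0}.
Proof.
apply: (ae0_bounded_potential (x := 1%g) (M := 2) mu_green) => // N.
apply: (@le_trans _ _ (\sum_(0 <= n < N.+1) steps n (escape \_ B) 1%g)).
  by rewrite big_nat_recr//= leeDl//; exact: steps_ge0.
rewrite big_ltn// (_ : 2%:E = 1 + 1)// leeD//; last exact: sum_steps_escape_le1.
by rewrite /= patchE; case: ifP => // _; exact: escape_le1.
Qed.

(** [steps k escape x] is the probability that [B] is not visited after time
    [k], and the limit is the probability of finitely many visits.  Unlike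
    [escape], it is harmonic. *)
Definition finite_visits x := limn (fun k => steps k escape x).

Let nd_steps x : nondecreasing_seq (fun k => steps k escape x).
Proof.
apply/nondecreasing_seqP => k; rewrite stepsSr; apply: le_steps => //.
  exact: measurable_step.
by move=> y; exact: (@le_steps_escape _ _ _ mu B mB 1).
Qed.

Let cvg_steps x : steps k escape x @[k --> \oo] --> finite_visits x.
Proof. exact: ereal_nondecreasing_is_cvgn. Qed.

Lemma le_steps_finite_visits k x : steps k escape x <= finite_visits x.
Proof.
rewrite /finite_visits (cvg_lim _ (ereal_nondecreasing_cvgn (@nd_steps x)))//.
by apply: ereal_sup_ubound; exists k.
Qed.

Lemma finite_visits_le1 x : finite_visits x <= 1.
Proof.
apply: lime_le; first exact: cvg_steps.
by apply: nearW => k; apply: steps_le1 => // y; exact: escape_le1.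
Qed.

Lemma measurable_finite_visits : measurable_fun [set: E] finite_visits.
Proof.
apply: (emeasurable_fun_cvg (fun k : nat => steps k escape)) => [k|x _].
  exact: measurable_steps.
exact: cvg_steps.
Qed.

Lemma step_finite_visits : step finite_visits = finite_visits.
Proof.
rewrite [LHS](step_lim mu (f_ := fun k => steps k escape)) //.
- apply/funext => x; apply/cvg_lim => //.
  by rewrite (cvg_shiftS (fun k => steps k escape x)); exact: cvg_steps.
- by move=> k; exact: measurable_steps.
- by move=> k x; exact: steps_ge0.
Qed.

(** At almost every point of [B] the last-visit decomposition degenerates to
    [steps k escape = escape = 0] for all [k], which provides a zero of the
    harmonic function [finite_visits]. *)
Lemma escape_eq0 x : escape x = 0.
Proof.
have fv0 y : 0 <= finite_visits y by exact: le_trans (esc0 y) (le_steps_finite_visits 0 y).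
suff fv_eq0 : finite_visits x = 0.
  have := le_steps_finite_visits 0 x; rewrite fv_eq0 => escx.
  by apply/eqP; rewrite eq_le esc0 andbT.
have [n [_ nsing]] := mu_spread.
apply: (@harmonic_eq0 _ _ _ pi mu pi_haar finite_visits n) => //.
- exact: measurable_finite_visits.
- exact: finite_visits_le1.
- exact: step_finite_visits.
have [y By yB] : exists2 y, B y & forall k, steps k (escape \_ B) y = 0.
  apply: ae_exists piB; apply: ae_foralln => k.
  exact: haar_ae_steps ae_escape_eq0.
have fvy : finite_visits y = 0.
  rewrite /finite_visits (_ : (fun k => _) = cst 0) ?lim_cst//.
  apply/funext => k; rewrite -sum_steps_escape// big1 ?add0e//.
  by have := yB 0%N; rewrite /= patchE mem_set.
apply: (@irreducible_ae0 _ _ _ pi mu _ y) => //; first exact: measurable_finite_visits.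
by elim=> // k IH; rewrite stepsSr step_finite_visits.
Qed.

End escape_eq0.

(** * From the transition operator to the sample paths *)

Section visits.
Context (d : measure_display) (E : lcscGroupType d) (R : realType).
Context (d' : measure_display) (Om : measurableType d').
Variables (mu : probability E R) (X : nat -> Om -> E) (P : E -> probability Om R).
Hypothesis walk : random_walk mu X P.

Let mX n : measurable_fun [set: Om] (X n). Proof. by case: walk. Qed.

Lemma measurable_visit n (B : set E) : measurable B -> measurable (X n @^-1` B).
Proof. by move=> mB; rewrite -[X in measurable X]setTI; exact: mX. Qed.

Lemma history_measurable m F : history X m F -> measurable F.
Proof.
apply; split; first exact: sigma_algebra_measurable.
by move=> G [k _] [B mB <-]; rewrite setTI; exact: measurable_visit.
Qed.

Lemma historyT m : history X m [set: Om].
Proof. by move=> G [[G0 GC _] _]; rewrite -setC0 -[~` _]setTD; exact: GC. Qed.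

Lemma history_visit m F B : history X m F -> measurable B ->
  history X m.+1 (F `&` X m.+1 @^-1` B).
Proof.
move=> hF mB.
pose G := \bigcup_(k in `I_m.+2) g_sigma_algebra_preimage (X k).
apply: (@measurableI _ (g_sigma_algebraType G)).
  by apply: sub_sigma_algebra2 hF; apply: bigcup_subset => k; exact: ltnW.
apply: sub_sigma_algebra; exists m.+1 => /=; first by [].
by exists B => //; rewrite setTI.
Qed.

(** The Markov property at time [m], for functions of the next position. *)
Lemma integral_walkS x m F (f : E -> \bar R) : history X m F ->
  measurable_fun [set: E] f -> (forall y, 0 <= f y) ->
  \int[P x]_(w in F) f (X m.+1 w) = \int[P x]_(w in F) step mu f (X m w).
Proof.
move=> hF mf f0; have mF := history_measurable hF.
have mgX n (g : E -> \bar R) : measurable_fun [set: E] g ->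
    measurable_fun F (fun w => g (X n w)).
  by move=> mg; apply: measurable_funTS; exact: measurableT_comp mg (mX n).
move: f mf f0; apply: ge0_measurable_ind.
- move=> A mA; transitivity (P x (F `&` X m.+1 @^-1` A)).
    by rewrite setIC; exact: (integral_indic (P x) mF (measurable_visit m.+1 mA)).
  have [_ _ /(_ x m 1%N F A hF mA)] := walk; rewrite addn1 => ->.
  by apply: eq_integral => w _; rewrite transitionE.
- move=> f g mf mg f0 g0 fE gE.
  rewrite (stepD mu mf mg f0 g0) ge0_integralD//; [|exact: mgX..].
  rewrite [RHS]ge0_integralD//; first by rewrite fE gE.
  + by move=> w _; exact: step_ge0.
  + by apply: mgX; exact: measurable_step.
  + by move=> w _; exact: step_ge0.
  + by apply: mgX; exact: measurable_step.
- move=> k f mf f0 k0 fE; rewrite (stepZ mu mf f0 k0) ge0_integralZl_EFin//; last exact: mgX.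
  rewrite [RHS]ge0_integralZl_EFin//; first by rewrite fE.
  + by move=> w _; exact: step_ge0.
  + by apply: mgX; exact: measurable_step.
- move=> f_ mf_ f_0 ndf fE; rewrite (step_lim mu mf_ f_0 ndf).
  rewrite [LHS](@monotone_convergence _ _ _ (P x) F mF (fun n w => f_ n (X m.+1 w))).
  + rewrite [RHS](@monotone_convergence _ _ _ (P x) F mF (fun n w => step mu (f_ n) (X m w))).
    * by under eq_fun do rewrite fE.
    * by move=> n; apply: mgX; exact: measurable_step.
    * by move=> n w _; exact: step_ge0.
    * by move=> w _ a b ab; apply: le_step => // y; exact: ndf.
  + by move=> n; exact: mgX.
  + by move=> n w _; exact: f_0.
  + by move=> w _; exact: ndf.
Qed.

(** Induction on [m], conditioning on the first step after time [k]: the event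
    that this step avoids [B] is absorbed into the past [F]. *)
Lemma probability_avoid x B m k F : measurable B -> history X k F ->
  P x (F `&` [set w | forall j, (j < m)%N -> ~ B (X (k.+1 + j)%N w)]) =
  \int[P x]_(w in F) avoid mu B m (X k w).
Proof.
move=> mB; elim: m k F => [|m IH] k F hF.
  rewrite (_ : [set w | _] = setT) ?setIT; last exact/seteqP.
  rewrite [RHS](integral_cst (P x) (history_measurable hF) 1).
  by rewrite mul1e.
have mBC := measurableC mB.
transitivity (P x ((F `&` X k.+1 @^-1` (~` B)) `&`
    [set w | forall j, (j < m)%N -> ~ B (X (k.+2 + j)%N w)])).
  congr (P x _); rewrite -setIA; congr (_ `&` _).
  apply/seteqP; split=> w /=.
    move=> h; split; first by have := h 0%N isT; rewrite addn0.
    by move=> j jm; have := h j.+1 jm; rewrite addnS.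
  by move=> [h0 h] [_|j jm]; [rewrite addn0|rewrite addnS; exact: h].
rewrite IH; last exact: history_visit.
rewrite integral_mkcondr avoidS -integral_walkS//.
- by apply: measurable_patch => //; exact: measurable_avoid.
- by move=> y; apply: erestrict_ge0 => z _; exact: avoid_ge0.
Qed.

(** A path with finitely many visits avoids [B] after some time [k], and by the
    Markov property that has probability [E (escape (X k)) = 0]. *)
Lemma infinitely_often_escape0 x B : measurable B ->
  (forall y, escape mu B y = 0) -> P x (infinitely_often X B) = 1.
Proof.
move=> mB escB.
have mio : measurable (infinitely_often X B).
  by apply: bigcap_measurable => // n _; apply: bigcup_measurable => k _; exact: measurable_visit.
pose T k := [set w | forall j, ~ B (X (k.+1 + j)%N w)].
have mS m k : measurable [set w | forall j, (j < m)%N -> ~ B (X (k.+1 + j)%N w)].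
  rewrite (_ : [set w | _] = \bigcap_(j in `I_m) X (k.+1 + j)%N @^-1` (~` B)) //.
  by apply: bigcap_measurableType => j _; exact/measurable_visit/measurableC.
have mT k : measurable (T k).
  rewrite (_ : T k = \bigcap_j X (k.+1 + j)%N @^-1` (~` B)).
    by apply: bigcap_measurableType => j _; exact/measurable_visit/measurableC.
  by apply/seteqP; split=> w /= h j; [move=> _|]; exact: h.
have PT0 k : P x (T k) = 0.
  apply/eqP; rewrite eq_le measure_ge0 andbT.
  have cv := @integral_avoid_cvg _ _ _ mu B mB _ _ (P x) (X k) setT measurableT (mX k).
  have {}cv : \int[P x]_w avoid mu B m (X k w) @[m --> \oo] --> 0.
    by move: cv; under [X in _ --> X]eq_integral do rewrite escB; rewrite integral0.
  rewrite -(cvg_lim _ cv)//; apply: lime_ge; first by apply/cvg_ex; exists 0.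
  apply: nearW => m; rewrite -(@probability_avoid x B m k setT mB (@historyT k)) setTI.
  apply: le_measure; [exact/mem_set|exact/mem_set|].
  by move=> w Tw j _; exact: Tw.
have : (P x).-negligible (~` infinitely_often X B).
  have : (P x).-negligible (\bigcup_k T k).
    by apply: negligible_bigcup => k; apply/(negligibleP _ (mT k)); exact: PT0.
  apply: negligibleS => w.
  rewrite /infinitely_often /lim_sup_set setC_bigcap => -[n _ nw].
  exists n => // j Bj; apply: nw; exists (n.+1 + j)%N => //=.
  by rewrite addSn -addnS leq_addr.
have mioC := measurableC mio.
move=> /(negligibleP _ mioC) io0.
by rewrite -[infinitely_often X B]setCK probability_setC// [X in 1 - X]io0 sube0.
Qed.

End visits.

(** * Tilting the law by an exponential *)

Section tilt.
Context (d : measure_display) (E : lcscGroupType d) (R : realType).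
Variables (v vt : probability E R) (rho : R) (phi : E -> R).
Hypothesis rho_gt0 : (0 < rho)%R.
Hypothesis phi_exp : exponential phi.
Hypothesis vtE : forall A : set E, measurable A ->
  vt A = rho%:E * \int[v]_(x in A) (phi x)%:E.
Local Notation ephi := (fun x : E => (phi x)%:E).

Let phi_gt0 x : (0 < phi x)%R. Proof. by case: phi_exp. Qed.
Let phi0 x : 0 <= ephi x. Proof. by rewrite lee_fin ltW. Qed.
Let mphi : measurable_fun [set: E] ephi.
Proof. by apply/measurable_EFinP; case: phi_exp. Qed.
Let mM (f : E -> \bar R) : measurable_fun [set: E] f ->
  measurable_fun [set: E] (fun x => ephi x * f x).
Proof. by move=> mf; exact: emeasurable_funM. Qed.
Let M0 (f : E -> \bar R) : (forall x, 0 <= f x) -> forall x, 0 <= ephi x * f x.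
Proof. by move=> f0 x; rewrite mule_ge0. Qed.

Lemma integral_tilt (f : E -> \bar R) : measurable_fun [set: E] f ->
  (forall x, 0 <= f x) ->
  \int[vt]_x f x = rho%:E * \int[v]_x (ephi x * f x).
Proof.
move: f; apply: ge0_measurable_ind.
- move=> A mA; transitivity (vt A); first by rewrite integral_indic// setIT.
  rewrite vtE//; congr (_ * _).
  by rewrite integral_mkcond; apply: eq_integral => x _; rewrite epatch_indic.
- move=> f g mf mg f0 g0 fE gE; rewrite ge0_integralD// fE gE.
  have int0 (h : E -> \bar R) : (forall x, 0 <= h x) ->
      0 <= \int[v]_x (ephi x * h x).
    by move=> h0; apply: integral_ge0 => x _; exact: M0.
  rewrite -ge0_muleDr; [|exact: int0|exact: int0].
  rewrite -ge0_integralD//.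
  + by congr (_ * _); apply: eq_integral => x _; rewrite ge0_muleDr.
  + by move=> x _; exact: M0.
  + exact: mM.
  + by move=> x _; exact: M0.
  + exact: mM.
- move=> k f mf f0 k0 fE; rewrite ge0_integralZl_EFin// fE muleCA; congr (_ * _).
  rewrite -ge0_integralZl_EFin//.
  + by apply: eq_integral => x _; rewrite muleCA.
  + by move=> x _; exact: M0.
  + exact: mM.
- move=> f_ mf_ f_0 ndf fE.
  have cvf x : f_ n x @[n --> \oo] --> limn (f_ ^~ x).
    exact: ereal_nondecreasing_is_cvgn.
  rewrite (@monotone_convergence _ _ _ vt _ measurableT f_)//.
  under eq_fun do rewrite fE.
  have -> : \int[v]_x (ephi x * limn (f_ ^~ x)) =
      limn (fun n => \int[v]_x (ephi x * f_ n x)).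
    rewrite -(@monotone_convergence _ _ _ v _ measurableT (fun n x => ephi x * f_ n x)).
    + by apply: eq_integral => x _; apply/esym/cvg_lim => //; exact: cvgeZl.
    + by move=> n; exact: mM.
    + by move=> n x _; exact: M0.
    + by move=> x _ a b ab; rewrite lee_wpmul2l//; exact: ndf.
  apply/cvg_lim => //; apply: cvgeZl => //.
  apply: ereal_nondecreasing_is_cvgn => a b ab.
  apply: ge0_le_integral => // [x _| | |x _].
  + exact: M0.
  + exact: mM.
  + exact: mM.
  + by rewrite lee_wpmul2l//; exact: ndf.
Qed.

(** Multiplicativity of [phi] splits the weight [phi (x y)] of the arrival point
    into the weight of the starting point and that of the increment. *)
Lemma step_tilt (f : E -> \bar R) x : measurable_fun [set: E] f ->
  (forall x, 0 <= f x) ->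
  ephi x * step vt f x = rho%:E * step v (fun y => ephi y * f y) x.
Proof.
move=> mf f0; rewrite /step (integral_tilt (measurable_comp_lmulg x mf))//.
rewrite muleCA -ge0_integralZl_EFin//.
- congr (_ * _); apply: eq_integral => y _.
  by rewrite muleA -EFinM; case: phi_exp => _ _ ->.
- by move=> y _; rewrite mule_ge0.
- by apply: mM; exact: measurable_comp_lmulg.
- exact: ltW.
Qed.

Lemma steps_tilt n (f : E -> \bar R) x : measurable_fun [set: E] f ->
  (forall x, 0 <= f x) ->
  ephi x * steps vt n f x = (rho ^+ n)%:E * steps v n (fun y => ephi y * f y) x.
Proof.
move=> mf f0; elim: n x => [|n IH] x; first by rewrite expr0 mul1e.
rewrite stepsS step_tilt; [|exact: measurable_steps|exact: steps_ge0].
rewrite (_ : (fun y => _) = fun y =>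
  (rho ^+ n)%:E * steps v n (fun y => ephi y * f y) y); last exact/funext.
rewrite stepZ; [|apply: measurable_steps|apply: steps_ge0|].
- by rewrite muleA -EFinM -exprS.
- exact: mM.
- exact: M0.
- exact: M0.
- by rewrite exprn_ge0// ltW.
Qed.

Lemma transition_tilt n x A : measurable A ->
  ephi x * transition vt n x A = (rho ^+ n)%:E * steps v n (ephi \_ A) x.
Proof.
move=> mA; rewrite transitionE// steps_tilt//.
  by rewrite epatch_indic.
exact/measurable_EFinP/measurable_indic.
Qed.

Lemma restrict_ae0 (m : probability E R) A : measurable A ->
  {ae m, forall x, (ephi \_ A) x = 0} <-> m A = 0.
Proof.
move=> mA; split=> [aeA|mA0].
  apply/(negligibleP _ mA); apply: negligibleS aeA => x Ax /=.
  by rewrite patchE mem_set// => /eqP; rewrite eqe gt_eqF.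
by exists A; split=> // x /=; rewrite patchE; case: ifPn => // /set_mem.
Qed.

Let mr A : measurable A -> measurable_fun [set: E] (ephi \_ A).
Proof. by move=> mA; exact: measurable_patch. Qed.
Let r0 A x : 0 <= (ephi \_ A) x.
Proof. by apply: erestrict_ge0 => y _; exact: phi0. Qed.

(** The density [rho^n phi] of the tilted power with respect to the power of
    [v] is positive. *)
Lemma tilt_power_null n A : measurable A ->
  convolution_power vt n A = 0 -> convolution_power v n A = 0.
Proof.
move=> mA A0; apply/(restrict_ae0 _ mA)/ge0_integral_eq0_ae => //; first exact: mr.
have pE (w : probability E R) (f : E -> \bar R) : measurable_fun [set: E] f ->
    (forall x, 0 <= f x) -> \int[convolution_power w n]_x f x = steps w n f 1%g.
  by move=> mf f0; rewrite -stepsE//; apply: eq_integral => y _; rewrite mul1g.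
rewrite pE//; last exact: mr.
have := transition_tilt n 1%g mA.
rewrite /transition invg1 (_ : [set (1 * y)%g | y in A] = A); last first.
  by under eq_imagel do rewrite mul1g; rewrite image_id.
rewrite A0 mule0 => /esym/eqP; rewrite mule_eq0 eqe expf_eq0 gt_eqF// andbF.
by move=> /eqP.
Qed.

Lemma tilt_null A : measurable A -> vt A = 0 <-> v A = 0.
Proof.
move=> mA; rewrite -(restrict_ae0 v mA) -ge0_integral_eq0_ae//; last exact: mr.
have <- : \int[v]_(x in A) ephi x = \int[v]_x (ephi \_ A) x by exact: integral_mkcond.
rewrite vtE//; split=> [/eqP|->]; last by rewrite mule0.
by rewrite mule_eq0 eqe gt_eqF//= => /eqP.
Qed.

Lemma adapted_tilt : adapted v -> adapted vt.
Proof.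
rewrite /adapted (_ : measure_support vt = measure_support v)//.
apply/seteqP; split=> x supp U oU Ux; have mU := open_borel oU.
  rewrite lt0e measure_ge0 andbT; apply/eqP => /(tilt_null mU) U0.
  by have := supp U oU Ux; rewrite U0 ltxx.
rewrite lt0e measure_ge0 andbT; apply/eqP => /(tilt_null mU) U0.
by have := supp U oU Ux; rewrite U0 ltxx.
Qed.

Variable pi : {measure set E -> \bar R}.

Lemma spread_out_tilt : spread_out pi v -> spread_out pi vt.
Proof.
move=> [n [n0 nsing]]; exists n; split=> // -[N [mN N0 piN]].
by apply: nsing; exists N; split=> //; exact: tilt_power_null.
Qed.

(** The weight [phi] need not be bounded below on [A], but it is on a positive
    subset [B] of [A], namely a level set of [phi] on [A]. *)
Lemma tilt_lower_bound A : positive_sets pi A -> exists (c : R) B,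
  [/\ (0 < c)%R, positive_sets pi B & forall n x,
   c%:E * ((rho ^+ n)%:E * transition v n x B) <= ephi x * transition vt n x A].
Proof.
move=> piA; have mA : measurable A by case: piA.
have [k kA] : exists k, positive_sets pi (level (ephi \_ A) k).
  apply: contrapT => /forallNP nA.
  have [x Ax] := ae_exists (ae0_level (mr mA) (r0 A) nA) piA.
  by rewrite patchE mem_set// => /eqP; rewrite eqe gt_eqF.
exists (k.+1%:R^-1)%R, (level (ephi \_ A) k); split=> // n x.
rewrite transition_tilt// muleCA lee_wpmul2l//; first by rewrite lee_fin exprn_ge0// ltW.
by apply: level_transition => //; exact: mr.
Qed.

Lemma irreducible_tilt : irreducible pi v -> irreducible pi vt.
Proof.
move=> irr x A /tilt_lower_bound[c [B [c0 piB cB]]].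
have [n [n0 Bn]] : exists n, (1 <= n)%N /\ transition v n x B != 0.
  apply: contrapT => /forallNP nB; have := irr x B piB; rewrite eseries0 ?ltxx// => n n1 _.
  by apply: contrapT => /eqP Bn; exact: (nB n).
apply: (@lt_le_trans _ _ (transition vt n x A)).
  rewrite -(pmule_rgt0 _ (_ : 0 < ephi x)) ?lte_fin//.
  apply: lt_le_trans (cB n x); rewrite !mule_gt0 ?lte_fin ?exprn_gt0//.
  by rewrite lt0e Bn measure_ge0.
apply: le_trans (nneseries_lim_ge n.+1 _); last by move=> *; exact: measure_ge0.
by rewrite big_nat_recr//= leeDr//; apply: sume_ge0 => *; exact: measure_ge0.
Qed.

(** The factors [rho^n] in the Green function of [v] are exactly those that the
    tilting produces. *)
Lemma green_tilt :
  (forall x A, positive_sets pi A -> green v rho x A = +oo) ->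
  forall x A, positive_sets pi A -> \sum_(n <oo) transition vt n x A = +oo.
Proof.
move=> gr x A /tilt_lower_bound[c [B [c0 piB cB]]].
suff : ephi x * \sum_(n <oo) transition vt n x A = +oo.
  move=> h; apply/eqP; rewrite -leye_eq leNgt; apply/negP => fin.
  by move: h; apply/eqP; rewrite lt_eqF// lte_mul_pinfty// nneseries_ge0// => *;
    exact: measure_ge0.
apply/eqP; rewrite -leye_eq -nneseriesZl; last by move=> *; exact: measure_ge0.
have <- : c%:E * green v rho x B = +oo by rewrite gr// gt0_muley.
rewrite /green -nneseriesZl; last by move=> *; rewrite mule_ge0// lee_fin exprn_ge0// ltW.
apply: lee_nneseries => [n _ _|n _]; last exact: cB.
by rewrite !mule_ge0 ?measure_ge0 ?lee_fin ?exprn_ge0 ?ltW.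
Qed.

End tilt.

(** * The tilted walk is a Harris random walk *)

Theorem theorem2 (R : realType) (d : measure_display) (E : lcscGroupType d)
    (pi : {measure set E -> \bar R}) (pi_haar : right_haar pi)
    (v : probability E R) (v_adapted : adapted v) (v_spread : spread_out pi v)
    (rho : R) (v_rho_recurrent : tweedie_recurrent pi v rho)
    (phi : E -> R) (phi_exp : exponential phi) (phi_cont : continuous phi)
    (phi_int : \int[v]_x (phi x)%:E = (rho^-1)%:E)
    (vt : probability E R)
    (vtE : forall A : set E, measurable A ->
      vt A = rho%:E * \int[v]_(x in A) (phi x)%:E)
    (d' : measure_display) (Om : measurableType d')
    (Xt : nat -> Om -> E) (P : E -> probability Om R)
    (Xt_walk : random_walk vt Xt P) :
  harris pi vt Xt P /\ recurrent_group E R.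
Proof.
have rho_gt0 : (0 < rho)%R.
  rewrite -invr_gt0 lt0r; apply/andP; split.
    apply/eqP => rho0; have := vtE setT measurableT.
    rewrite phi_int rho0 mule0 probability_setT => /eqP.
    by rewrite eqe oner_eq0.
  rewrite -lee_fin -phi_int; apply: integral_ge0 => x _.
  by rewrite lee_fin ltW//; case: phi_exp.
case: v_rho_recurrent => v_irr _ v_green.
have vt_irr := irreducible_tilt rho_gt0 phi_exp vtE v_irr.
have vt_spread := spread_out_tilt rho_gt0 phi_exp vtE v_spread.
have vt_green := green_tilt rho_gt0 phi_exp vtE v_green.
have vt_io x B : positive_sets pi B -> P x (infinitely_often Xt B) = 1.
  move=> piB; have [mB _] := piB.
  by apply: (infinitely_often_escape0 Xt_walk) => // y; exact: escape_eq0 piB y.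
split; first by split.
exists d', Om, vt, Xt, P; split=> //; first exact: adapted_tilt vtE v_adapted.
move=> x U oU U0; apply: vt_io; split; first exact: open_borel.
exact: haar_open_gt0.
Qed.
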